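(* Let $\mathfrak{N}$ be a coalgebra in a monoidal category $\mathcal{C}$ with coproduct $\Delta_{\mathfrak{N}}$, and let $\eta=\eta_{\mathfrak N}:1\to\mathfrak{N}$ be a fixed coalgebra morphism. For every $M\in\mathcal{C}$, the vector space $\mathrm{Ext}^1_{\mathrm{Comod}(\mathfrak{N}),\,\mathcal{C}\,\mathrm{split}}(M_\eta,1_\eta)$ of $\mathcal{C}$-split extensions between trivial $\mathfrak{N}$-comodules is isomorphic to the vector space $\mathrm{Hom}_{\mathcal{C}}(M,\mathfrak{N}^{\mathrm{prim}})$, where the $\mathcal{C}$-subobject $\mathfrak{N}^{\mathrm{prim}}$ of $\mathfrak{N}$ is defined as the equalizer of $\Delta_{\mathfrak{N}}$ and $\mathrm{id}\otimes\eta_{\mathfrak N}+\eta_{\mathfrak N}\otimes\mathrm{id}$.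
   Context: All categories are $\mathbb{C}$-linear and abelian; $1$ is the tensor unit of $\mathcal{C}$. For $M\in\mathcal{C}$, $M_\eta$ denotes the $\mathfrak{N}$-comodule with underlying object $M$ and trivial coaction $M\cong 1\otimes M\xrightarrow{\eta\otimes\mathrm{id}}\mathfrak{N}\otimes M$. $\mathrm{Ext}^1(X,Y)$ denotes equivalence classes of short exact sequences $Y\to E\to X$. Such an extension of $\mathfrak{N}$-comodules is called $\mathcal{C}$-split if the underlying extension in $\mathcal{C}$ splits, that is, $E\cong Y\oplus X$ as an extension in $\mathcal{C}$. The morphisms $\mathrm{id}\otimes\eta$ and $\eta\otimes\mathrm{id}$ are regarded as morphisms $\mathfrak{N}\to\mathfrak{N}\otimes\mathfrak{N}$ via the unit constraints. *)

(* Defs.v *)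
From HB Require Import structures.
From mathcomp Require Import all_boot all_order all_algebra.
From mathcomp Require Import boolp reals complex.

Set Implicit Arguments.
Unset Strict Implicit.
Unset Printing Implicit Defensive.

Import GRing.Theory.
Local Open Scope ring_scope.
Local Open Scope quotient_scope.

Reserved Notation "g \co f" (at level 40, left associativity).
Reserved Notation "X \ox Y" (at level 40, left associativity).
Reserved Notation "f \om g" (at level 40, left associativity).

Record lincat (k : fieldType) := LinCat {
  ob :> Type;
  mor : ob -> ob -> lmodType k;
  idm : forall X, mor X X;
  compm : forall X Y Z, mor Y Z -> mor X Y -> mor X Z;
  compmA : forall X Y Z T (h : mor Z T) (g : mor Y Z) (f : mor X Y),
    compm h (compm g f) = compm (compm h g) f;
  comp1m : forall X Y (f : mor X Y), compm (idm Y) f = f;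
  compm1 : forall X Y (f : mor X Y), compm f (idm X) = f;
  comp_linl : forall X Y Z (f : mor X Y),
    linear (fun g : mor Y Z => compm g f);
  comp_linr : forall X Y Z (g : mor Y Z),
    linear (fun f : mor X Y => compm g f) }.

Notation "g \co f" := (compm g f) : ring_scope.
Arguments idm {k l} X.
Arguments mor {k l} X Y.

Section CatNotions.
Variables (k : fieldType) (C : lincat k).
Implicit Types X Y Z K T : C.

Definition is_iso X Y (f : mor X Y) : Prop :=
  exists g : mor Y X, g \co f = idm X /\ f \co g = idm Y.

Definition is_monic X Y (f : mor X Y) : Prop :=
  forall T (g h : mor T X), f \co g = f \co h -> g = h.

Definition is_epic X Y (f : mor X Y) : Prop :=
  forall T (g h : mor Y T), g \co f = h \co f -> g = h.

Definition is_kernel K X Y (i : mor K X) (f : mor X Y) : Prop :=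
  f \co i = 0 /\
  forall T (t : mor T X), f \co t = 0 -> exists! u : mor T K, i \co u = t.

Definition is_cokernel X Y K (p : mor Y K) (f : mor X Y) : Prop :=
  p \co f = 0 /\
  forall T (t : mor Y T), t \co f = 0 -> exists! u : mor K T, u \co p = t.

Definition is_pullback P X1 X2 Y (q1 : mor P X1) (q2 : mor P X2)
    (f1 : mor X1 Y) (f2 : mor X2 Y) : Prop :=
  f1 \co q1 = f2 \co q2 /\
  forall T (t1 : mor T X1) (t2 : mor T X2), f1 \co t1 = f2 \co t2 ->
    exists! u : mor T P, q1 \co u = t1 /\ q2 \co u = t2.

Definition is_pushout X Y1 Y2 P (f1 : mor X Y1) (f2 : mor X Y2)
    (q1 : mor Y1 P) (q2 : mor Y2 P) : Prop :=
  q1 \co f1 = q2 \co f2 /\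
  forall T (t1 : mor Y1 T) (t2 : mor Y2 T), t1 \co f1 = t2 \co f2 ->
    exists! u : mor P T, u \co q1 = t1 /\ u \co q2 = t2.

Record equalizer X Y (f g : mor X Y) := Equalizer {
  eqz_ob :> C;
  eqz_map : mor eqz_ob X;
  eqz_comm : f \co eqz_map = g \co eqz_map;
  eqz_univ : forall T (t : mor T X), f \co t = g \co t ->
    exists! u : mor T eqz_ob, eqz_map \co u = t }.

Record biproduct Y X := Biproduct {
  bp_ob :> C;
  injl : mor Y bp_ob;
  injr : mor X bp_ob;
  prl : mor bp_ob Y;
  prr : mor bp_ob X;
  prl_injl : prl \co injl = idm Y;
  prr_injr : prr \co injr = idm X;
  prl_injr : prl \co injr = 0;
  prr_injl : prr \co injl = 0;
  bp_id : injl \co prl + injr \co prr = idm bp_ob }.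

Definition abelian : Prop :=
  [/\ exists Z : C, idm Z = 0,
      forall Y X, inhabited (biproduct Y X),
      forall X Y (f : mor X Y), exists K (i : mor K X), is_kernel i f,
      forall X Y (f : mor X Y), exists K (p : mor Y K), is_cokernel p f
    & (forall X Y (f : mor X Y), is_monic f ->
         exists Z (g : mor Y Z), is_kernel f g) /\
      (forall X Y (f : mor X Y), is_epic f ->
         exists Z (g : mor Z X), is_cokernel f g)].

(* Short exact sequences Y -> E -> X, representing elements of Ext^1(X, Y). *)
Record extension X Y := Extension {
  ext_ob :> C;
  ext_i : mor Y ext_ob;
  ext_p : mor ext_ob X;
  ext_ker : is_kernel ext_i ext_p;
  ext_coker : is_cokernel ext_p ext_i }.

Definition ext_equiv X Y (E E' : extension X Y) : Prop :=
  exists h : mor E E',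
    [/\ is_iso h, h \co ext_i E = ext_i E' & ext_p E' \co h = ext_p E].

(* E3 is the Baer sum of E1 and E2: with P := E1 x_X E2, E3 is the quotient of
   P by the skew diagonal {(y, -y)} of Y (+) Y, the latter being embedded in P
   by a (first summand) and b (second summand). *)
Definition is_baer_sum X Y (E1 E2 E3 : extension X Y) : Prop :=
  exists P (q1 : mor P E1) (q2 : mor P E2) (a b : mor Y P) (h : mor P E3),
    [/\ is_pullback q1 q2 (ext_p E1) (ext_p E2),
        q1 \co a = ext_i E1 /\ q2 \co a = 0,
        q1 \co b = 0 /\ q2 \co b = ext_i E2,
        is_cokernel h (a - b)
      & ext_i E3 = h \co a /\ ext_p E3 \co h = ext_p E1 \co q1].

(* E' is c.E: the pushout of E along multiplication by c on Y. *)
Definition is_ext_scale (c : k) X Y (E E' : extension X Y) : Prop :=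
  exists h : mor E E',
    is_pushout (ext_i E) (c *: idm Y) h (ext_i E') /\
    ext_p E' \co h = ext_p E.

End CatNotions.

(* k-linear abelian monoidal categories: the tensor product is bilinear on
   morphisms, but is not assumed to be exact. *)
Record moncat (k : fieldType) := MonCat {
  mcat :> lincat k;
  cat_abelian : abelian mcat;
  tens : mcat -> mcat -> mcat;
  tensm : forall X X' Y Y' : mcat,
    mor X X' -> mor Y Y' -> mor (tens X Y) (tens X' Y');
  tens_id : forall X Y, tensm (idm X) (idm Y) = idm (tens X Y);
  tens_comp : forall X X' X'' Y Y' Y'' (f' : mor X' X'') (f : mor X X')
      (g' : mor Y' Y'') (g : mor Y Y'),
    tensm (f' \co f) (g' \co g) = tensm f' g' \co tensm f g;
  tens_linl : forall X X' Y Y' (g : mor Y Y'),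
    linear (fun f : mor X X' => tensm f g);
  tens_linr : forall X X' Y Y' (f : mor X X'),
    linear (fun g : mor Y Y' => tensm f g);
  munit : mcat;
  asc : forall X Y Z, mor (tens (tens X Y) Z) (tens X (tens Y Z));
  lun : forall X, mor (tens munit X) X;
  run : forall X, mor (tens X munit) X;
  ascV : forall X Y Z, mor (tens X (tens Y Z)) (tens (tens X Y) Z);
  lunV : forall X, mor X (tens munit X);
  runV : forall X, mor X (tens X munit);
  ascK : forall X Y Z, ascV X Y Z \co asc X Y Z = idm _;
  ascVK : forall X Y Z, asc X Y Z \co ascV X Y Z = idm _;
  lunK : forall X, lunV X \co lun X = idm _;
  lunVK : forall X, lun X \co lunV X = idm _;
  runK : forall X, runV X \co run X = idm _;
  runVK : forall X, run X \co runV X = idm _;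
  asc_nat : forall X X' Y Y' Z Z' (f : mor X X') (g : mor Y Y') (h : mor Z Z'),
    asc X' Y' Z' \co tensm (tensm f g) h = tensm f (tensm g h) \co asc X Y Z;
  lun_nat : forall X X' (f : mor X X'),
    lun X' \co tensm (idm munit) f = f \co lun X;
  run_nat : forall X X' (f : mor X X'),
    run X' \co tensm f (idm munit) = f \co run X;
  pentagon : forall X Y Z T,
    asc X Y (tens Z T) \co asc (tens X Y) Z T =
    tensm (idm X) (asc Y Z T) \co asc X (tens Y Z) T
      \co tensm (asc X Y Z) (idm T);
  triangle : forall X Y,
    tensm (idm X) (lun Y) \co asc X munit Y = tensm (run X) (idm Y) }.

Notation "X \ox Y" := (tens X Y) : ring_scope.
Notation "f \om g" := (tensm f g) : ring_scope.
Arguments munit {k} m : rename.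
Arguments asc {k m} X Y Z.
Arguments lun {k m} X.
Arguments run {k m} X.
Arguments ascV {k m} X Y Z.
Arguments lunV {k m} X.
Arguments runV {k m} X.

Section CatLemmas.
Variables (k : fieldType) (C : lincat k).
Implicit Types X Y Z T : C.

Lemma compDl X Y Z (f g : mor Y Z) (h : mor X Y) :
  (f + g) \co h = f \co h + g \co h.
Proof. by have := comp_linl h 1 f g; rewrite !scale1r. Qed.

Lemma compDr X Y Z (h : mor Y Z) (f g : mor X Y) :
  h \co (f + g) = h \co f + h \co g.
Proof. by have := comp_linr h 1 f g; rewrite !scale1r. Qed.

Lemma comp0m X Y Z (h : mor X Y) : (0 : mor Y Z) \co h = 0.
Proof. by apply: (addrI (0 \co h)); rewrite -compDl !addr0. Qed.

Lemma compm0 X Y Z (h : mor Y Z) : h \co (0 : mor X Y) = 0.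
Proof. by apply: (addrI (h \co 0)); rewrite -compDr !addr0. Qed.

Lemma compZl X Y Z (c : k) (g : mor Y Z) (h : mor X Y) :
  (c *: g) \co h = c *: (g \co h).
Proof. by have := comp_linl h c g 0; rewrite comp0m !addr0. Qed.

Lemma compZr X Y Z (c : k) (h : mor Y Z) (g : mor X Y) :
  h \co (c *: g) = c *: (h \co g).
Proof. by have := comp_linr h c g 0; rewrite compm0 !addr0. Qed.

Lemma compNl X Y Z (g : mor Y Z) (h : mor X Y) : (- g) \co h = - (g \co h).
Proof. by rewrite -scaleN1r compZl scaleN1r. Qed.

Lemma compNr X Y Z (h : mor Y Z) (g : mor X Y) : h \co (- g) = - (h \co g).
Proof. by rewrite -scaleN1r compZr scaleN1r. Qed.

Lemma abelian_equalizer (abC : abelian C) X Y (f g : mor X Y) :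
  inhabited (equalizer f g).
Proof.
have [_ _ /(_ X Y (f - g)) [K [i [fi iu]]] _ _] := abC.
have subE T (t : mor T X) : ((f - g) \co t = 0) <-> (f \co t = g \co t).
  by rewrite compDl compNl; split=> [/subr0_eq|->]; rewrite ?subrr.
split; apply: (@Equalizer _ C X Y f g K i); first exact/subE.
by move=> T t /subE; apply: iu.
Qed.

Lemma ext_equiv_refl X Y (E : extension X Y) : ext_equiv E E.
Proof.
exists (idm E); split; [by exists (idm E); rewrite comp1m|exact: comp1m|].
exact: compm1.
Qed.

Lemma ext_equiv_sym X Y (E E' : extension X Y) :
  ext_equiv E E' -> ext_equiv E' E.
Proof.
case=> h [[g [gh hg]] hi ph]; exists g; split; first by exists h.
  by rewrite -hi compmA gh comp1m.
by rewrite -ph -compmA hg compm1.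
Qed.

Lemma ext_equiv_trans X Y (E E' E'' : extension X Y) :
  ext_equiv E E' -> ext_equiv E' E'' -> ext_equiv E E''.
Proof.
case=> h [[g [gh hg]] hi ph] [h' [[g' [gh' hg']] hi' ph']].
exists (h' \co h); split.
- exists (g \co g'); split.
    by rewrite -compmA (compmA g') gh' comp1m.
  by rewrite -compmA (compmA h) hg comp1m.
- by rewrite -compmA hi.
- by rewrite compmA ph'.
Qed.

Lemma is_cokernel_epic X Y Z (p : mor Y Z) (f : mor X Y) :
  is_cokernel p f -> is_epic p.
Proof.
case=> pf univ T g h gh.
have [|u [_ uq]] := univ T (g \co p); first by rewrite -compmA pf compm0.
by rewrite -(uq g erefl) -(uq h (esym gh)).
Qed.

Lemma is_pullback_ext P X1 X2 Y (q1 : mor P X1) (q2 : mor P X2)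
    (f1 : mor X1 Y) (f2 : mor X2 Y) : is_pullback q1 q2 f1 f2 ->
  forall T (u v : mor T P), q1 \co u = q1 \co v -> q2 \co u = q2 \co v -> u = v.
Proof.
case=> sq univ T u v e1 e2.
have [|w [_ wq]] := univ T (q1 \co u) (q2 \co u); first by rewrite !compmA sq.
transitivity w; first by apply/esym/(wq u).
by apply: (wq v); rewrite -e1 -e2.
Qed.

Lemma baer_sum_unique X Y (E1 E2 E E' : extension X Y) :
  is_baer_sum E1 E2 E -> is_baer_sum E1 E2 E' -> ext_equiv E E'.
Proof.
have main (F F' : extension X Y) P (q1 : mor P E1) (q2 : mor P E2) (a b : mor Y P) (h : mor P F)
      P' (q1' : mor P' E1) (q2' : mor P' E2) (a' b' : mor Y P') (h' : mor P' F') :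
    [/\ is_pullback q1 q2 (ext_p E1) (ext_p E2),
        q1 \co a = ext_i E1 /\ q2 \co a = 0,
        q1 \co b = 0 /\ q2 \co b = ext_i E2,
        is_cokernel h (a - b)
      & ext_i F = h \co a /\ ext_p F \co h = ext_p E1 \co q1] ->
    [/\ is_pullback q1' q2' (ext_p E1) (ext_p E2),
        q1' \co a' = ext_i E1 /\ q2' \co a' = 0,
        q1' \co b' = 0 /\ q2' \co b' = ext_i E2,
        is_cokernel h' (a' - b')
      & ext_i F' = h' \co a' /\ ext_p F' \co h' = ext_p E1 \co q1'] ->
    exists (u : mor P P') (w : mor F F'),
      [/\ q1' \co u = q1, q2' \co u = q2, w \co h = h' \co u,
          w \co ext_i F = ext_i F' & ext_p F' \co w = ext_p F].
  move=> [pb [a1 a2] [b1 b2] ck [iF pF]] [pb' [a1' a2'] [b1' b2'] ck' [iF' pF']].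
  have [u [[u1 u2] _]] := pb'.2 _ q1 q2 pb.1.
  have ua : u \co a = a'.
    by apply: (is_pullback_ext pb'); rewrite compmA ?u1 ?u2 ?a1 ?a2 ?a1' ?a2'.
  have ub : u \co b = b'.
    by apply: (is_pullback_ext pb'); rewrite compmA ?u1 ?u2 ?b1 ?b2 ?b1' ?b2'.
  have [|w [wh _]] := ck.2 _ (h' \co u).
    by rewrite -compmA compDr compNr ua ub ck'.1.
  exists u, w; split=> //.
    by rewrite iF iF' compmA wh -compmA ua.
  apply: (is_cokernel_epic ck).
  by rewrite -compmA wh compmA pF' -compmA u1 pF.
case=> P [q1 [q2 [a [b [h H]]]]]; case=> P' [q1' [q2' [a' [b' [h' H']]]]].
have [u [w [u1 u2 wh wi wp]]] := main _ _ _ _ _ _ _ _ _ _ _ _ _ _ H H'.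
have [u' [w' [u1' u2' wh' wi' wp']]] := main _ _ _ _ _ _ _ _ _ _ _ _ _ _ H' H.
case: H => pb _ _ ck _; case: H' => pb' _ _ ck' _.
exists w; split=> //; exists w'; split.
  apply: (is_cokernel_epic ck); rewrite comp1m -compmA wh compmA wh' -compmA.
  rewrite (_ : u' \co u = idm P) ?compm1 //.
  by apply: (is_pullback_ext pb); rewrite compmA compm1 ?u1' ?u2'.
apply: (is_cokernel_epic ck'); rewrite comp1m -compmA wh' compmA wh -compmA.
rewrite (_ : u \co u' = idm P') ?compm1 //.
by apply: (is_pullback_ext pb'); rewrite compmA compm1 ?u1 ?u2.
Qed.

Lemma baer_sum_transport X Y (E1 E1' E2 E2' E : extension X Y) :
  ext_equiv E1 E1' -> ext_equiv E2 E2' ->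
  is_baer_sum E1 E2 E -> is_baer_sum E1' E2' E.
Proof.
move=> [h1 [[g1 [gh1 hg1]] hi1 ph1]] [h2 [[g2 [gh2 hg2]] hi2 ph2]].
move=> [P [q1 [q2 [a [b [h [pb [a1 a2] [b1 b2] ck [iE pE]]]]]]]].
have pg1 : ext_p E1 \co g1 = ext_p E1' by rewrite -ph1 -compmA hg1 compm1.
have pg2 : ext_p E2 \co g2 = ext_p E2' by rewrite -ph2 -compmA hg2 compm1.
exists P, (h1 \co q1), (h2 \co q2), a, b, h; split=> //.
- split; first by rewrite !compmA ph1 ph2 pb.1.
  move=> T t1 t2 e.
  have [|u [[u1 u2] uq]] := pb.2 T (g1 \co t1) (g2 \co t2).
    by rewrite !compmA pg1 pg2.
  exists u; split.
    by rewrite -!compmA u1 u2 !compmA hg1 hg2 !comp1m.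
  move=> v [v1 v2]; apply: uq.
  by rewrite -v1 -v2 !compmA gh1 gh2 !comp1m.
- by rewrite -!compmA a1 a2 compm0.
- by rewrite -!compmA b1 b2 compm0.
- by rewrite compmA ph1.
Qed.

Lemma ext_scale_unique (c : k) X Y (E E1 E2 : extension X Y) :
  is_ext_scale c E E1 -> is_ext_scale c E E2 -> ext_equiv E1 E2.
Proof.
move=> [h1 [po1 ph1]] [h2 [po2 ph2]].
have uniq (F : extension X Y) (h : mor E F) :
    is_pushout (ext_i E) (c *: idm Y) h (ext_i F) ->
    forall T (u v : mor F T), u \co h = v \co h ->
      u \co ext_i F = v \co ext_i F -> u = v.
  case=> sq univ T u v e1 e2.
  have [|w [_ wq]] := univ T (u \co h) (u \co ext_i F).
    by rewrite -!compmA sq.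
  by rewrite -(wq u) // -(wq v) // e1 e2.
have [u [[uh ui] _]] := po1.2 _ h2 (ext_i E2) po2.1.
have [v [[vh vi] _]] := po2.2 _ h1 (ext_i E1) po1.1.
exists u; split=> //.
  exists v; split.
    by apply: (uniq _ _ po1); rewrite -compmA ?uh ?ui comp1m.
  by apply: (uniq _ _ po2); rewrite -compmA ?vh ?vi comp1m.
apply: (uniq _ _ po1); first by rewrite -compmA uh ph1.
by rewrite -compmA ui (ext_ker E1).1 (ext_ker E2).1.
Qed.

Lemma ext_scale_transport (c : k) X Y (E E' F : extension X Y) :
  ext_equiv E E' -> is_ext_scale c E F -> is_ext_scale c E' F.
Proof.
move=> [h [[g [gh hg]] hi ph]] [w [po pw]].
have gi : g \co ext_i E' = ext_i E by rewrite -hi compmA gh comp1m.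
exists (w \co g); split; last by rewrite compmA pw -ph -compmA hg compm1.
split; first by rewrite -compmA gi po.1.
move=> T t1 t2 e.
have [|u [[u1 u2] uq]] := po.2 T (t1 \co h) t2; first by rewrite -compmA hi.
exists u; split; first by rewrite compmA u1 -compmA hg compm1.
by move=> v [v1 v2]; apply: uq; rewrite -v1 v2 -!compmA gh compm1.
Qed.

End CatLemmas.

Section MonLemmas.
Variables (k : fieldType) (C : moncat k).
Implicit Types X Y Z T : C.

Lemma tensDl X X' Y Y' (f f' : mor X X') (g : mor Y Y') :
  (f + f') \om g = f \om g + f' \om g.
Proof. by have := tens_linl g 1 f f'; rewrite !scale1r. Qed.

Lemma tensDr X X' Y Y' (f : mor X X') (g g' : mor Y Y') :
  f \om (g + g') = f \om g + f \om g'.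
Proof. by have := tens_linr f 1 g g'; rewrite !scale1r. Qed.

Lemma tensm0 X X' Y Y' (f : mor X X') : f \om (0 : mor Y Y') = 0.
Proof. by apply: (addrI (f \om 0)); rewrite -tensDr !addr0. Qed.

Lemma tensZr (c : k) X X' Y Y' (f : mor X X') (g : mor Y Y') :
  f \om (c *: g) = c *: (f \om g).
Proof. by have := tens_linr f c g 0; rewrite tensm0 !addr0. Qed.

Lemma tens1_comp X Y Y' Y'' (g' : mor Y' Y'') (g : mor Y Y') :
  idm X \om (g' \co g) = (idm X \om g') \co (idm X \om g).
Proof. by rewrite -tens_comp comp1m. Qed.

Lemma tens_comp1 X X' X'' Y (f' : mor X' X'') (f : mor X X') :
  (f' \co f) \om idm Y = (f' \om idm Y) \co (f \om idm Y).
Proof. by rewrite -tens_comp comp1m. Qed.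

Lemma tens_swap X X' Y Y' (f : mor X X') (g : mor Y Y') :
  (f \om idm Y') \co (idm X \om g) = (idm X' \om g) \co (f \om idm Y).
Proof. by rewrite -!tens_comp !comp1m !compm1. Qed.

Lemma lunV_nat X X' (f : mor X X') :
  (idm (munit C) \om f) \co lunV X = lunV X' \co f.
Proof.
rewrite -[LHS]comp1m -(lunK X') -!compmA; congr (_ \co _).
by rewrite compmA lun_nat -compmA lunVK compm1.
Qed.

Lemma runV_nat X X' (f : mor X X') :
  (f \om idm (munit C)) \co runV X = runV X' \co f.
Proof.
rewrite -[LHS]comp1m -(runK X') -!compmA; congr (_ \co _).
by rewrite compmA run_nat -compmA runVK compm1.
Qed.

Lemma unit_tens_inj X X' (f g : mor X X') :
  idm (munit C) \om f = idm (munit C) \om g -> f = g.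
Proof.
move=> e; rewrite -(compm1 f) -(compm1 g) -(lunVK X) !compmA.
by rewrite -!lun_nat e.
Qed.

Lemma tens_unit_inj X X' (f g : mor X X') :
  f \om idm (munit C) = g \om idm (munit C) -> f = g.
Proof.
move=> e; rewrite -(compm1 f) -(compm1 g) -(runVK X) !compmA.
by rewrite -!run_nat e.
Qed.

Lemma comp_asc_inj X Y Z T (f g : mor (X \ox (Y \ox Z)) T) :
  f \co asc X Y Z = g \co asc X Y Z -> f = g.
Proof.
move=> e; rewrite -(compm1 f) -(compm1 g) -ascVK !compmA.
by rewrite e.
Qed.

Lemma lun_tens X Y :
  lun (X \ox Y) \co asc (munit C) X Y = lun X \om idm Y.
Proof.
apply: unit_tens_inj; apply: comp_asc_inj.
set I := munit C.
have inj (f g : mor ((I \ox (I \ox X)) \ox Y) (I \ox (X \ox Y))) :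
    f \co (asc I I X \om idm Y) = g \co (asc I I X \om idm Y) -> f = g.
  move=> e; rewrite -(compm1 f) -(compm1 g) -tens_id -(ascVK I I X).
  by rewrite tens_comp1 !compmA e.
apply: inj; rewrite tens1_comp -!compmA (compmA (idm I \om asc I X Y)) -pentagon.
rewrite compmA triangle -tens_id -asc_nat.
rewrite [RHS]compmA -asc_nat -compmA.
by rewrite -tens_comp triangle comp1m.
Qed.

Lemma lun_run_unit : lun (munit C) = run (munit C).
Proof.
apply: tens_unit_inj; rewrite -lun_tens -triangle; congr (_ \co _).
have inj (f g : mor (munit C \ox (munit C \ox munit C)) (munit C \ox munit C)) :
    lun (munit C) \co f = lun (munit C) \co g -> f = g.
  by move=> e; rewrite -(comp1m f) -(comp1m g) -(lunK (munit C)) -!compmA e.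
by apply: inj; rewrite lun_nat.
Qed.

Lemma lunV_runV_unit : lunV (munit C) = runV (munit C).
Proof.
by rewrite -[LHS]comp1m -(runK (munit C)) -lun_run_unit -compmA lunVK compm1.
Qed.

Lemma asc_lunV X :
  asc (munit C) (munit C) X \co (lunV (munit C) \om idm X)
  = idm (munit C) \om lunV X.
Proof.
rewrite -[LHS]comp1m -tens_id -(lunK X) tens1_comp -compmA.
rewrite (compmA (idm _ \om lun X)) triangle -tens_comp comp1m.
by rewrite lunV_runV_unit runVK tens_id compm1.
Qed.

End MonLemmas.

Section Comodules.
Variables (k : fieldType) (C : moncat k).

Record coalgebra := Coalgebra {
  coalg_ob :> C;
  comul : mor coalg_ob (coalg_ob \ox coalg_ob);
  counit : mor coalg_ob (munit C);
  comulA : asc _ _ _ \co (comul \om idm _) \co comul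
           = (idm _ \om comul) \co comul;
  counitl : lun _ \co (counit \om idm _) \co comul = idm _;
  counitr : run _ \co (idm _ \om counit) \co comul = idm _ }.

Definition is_coalg_hom (A B : coalgebra) (f : mor A B) : Prop :=
  comul B \co f = (f \om f) \co comul A /\ counit B \co f = counit A.

Fact unit_comulA :
  asc _ _ _ \co (lunV (munit C) \om idm _) \co lunV (munit C)
  = (idm _ \om lunV (munit C)) \co lunV (munit C).
Proof. by rewrite asc_lunV. Qed.

Fact unit_counitl :
  lun _ \co (idm (munit C) \om idm _) \co lunV (munit C) = idm _.
Proof. by rewrite tens_id compm1 lunVK. Qed.

Fact unit_counitr :
  run _ \co (idm _ \om idm (munit C)) \co lunV (munit C) = idm _.
Proof. by rewrite tens_id compm1 lunV_runV_unit runVK. Qed.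

Definition unit_coalgebra : coalgebra :=
  Coalgebra unit_comulA unit_counitl unit_counitr.

Record comodule (N : coalgebra) := Comodule {
  comod_ob :> C;
  coact : mor comod_ob (N \ox comod_ob);
  coactA : asc _ _ _ \co (comul N \om idm _) \co coact
           = (idm _ \om coact) \co coact;
  coact1 : lun _ \co (counit N \om idm _) \co coact = idm _ }.

Section Comod.
Variable N : coalgebra.
Implicit Types X Y Z T : comodule N.

Definition comod_hom_pred X Y : {pred mor X Y} :=
  fun f => `[< coact Y \co f = (idm N \om f) \co coact X >].

Arguments comod_hom_pred : clear implicits.

Fact comod_hom_submod X Y : submod_closed (comod_hom_pred X Y).
Proof.
split; first by apply/asboolP; rewrite compm0 tensm0 comp0m.
move=> c f g /asboolP ef /asboolP eg; apply/asboolP.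
by rewrite compDr compZr tensDr tensZr compDl compZl ef eg.
Qed.

HB.instance Definition _ X Y :=
  GRing.isSubmodClosed.Build k (mor X Y) (comod_hom_pred X Y)
    (comod_hom_submod X Y).

Record comod_hom X Y := ComodHom {
  comod_hom_val :> mor X Y;
  comod_hom_valP : comod_hom_val \in comod_hom_pred X Y }.

HB.instance Definition _ X Y := [isSub for @comod_hom_val X Y].
HB.instance Definition _ X Y := [Choice of comod_hom X Y by <:].
HB.instance Definition _ X Y :=
  [SubChoice_isSubLmodule of comod_hom X Y by <:].

Lemma comod_homE X Y (f : comod_hom X Y) :
  coact Y \co f = (idm N \om (f : mor X Y)) \co coact X.
Proof. by have /asboolP := comod_hom_valP f. Qed.

Definition mk_comod_hom X Y (f : mor X Y)
    (e : coact Y \co f = (idm N \om f) \co coact X) : comod_hom X Y :=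
  ComodHom (asboolT e).

Fact comod_idP X : coact X \co idm X = (idm N \om idm X) \co coact X.
Proof. by rewrite tens_id comp1m compm1. Qed.

Fact comod_compP X Y Z (g : comod_hom Y Z) (f : comod_hom X Y) :
  coact Z \co ((g : mor Y Z) \co (f : mor X Y))
  = (idm N \om ((g : mor Y Z) \co (f : mor X Y))) \co coact X.
Proof. by rewrite compmA comod_homE -compmA comod_homE tens1_comp compmA. Qed.

Definition comod_comp X Y Z (g : comod_hom Y Z) (f : comod_hom X Y) :=
  mk_comod_hom (comod_compP g f).

Fact comod_compA X Y Z T (h : comod_hom Z T) (g : comod_hom Y Z)
    (f : comod_hom X Y) :
  comod_comp h (comod_comp g f) = comod_comp (comod_comp h g) f.
Proof. by apply: val_inj; rewrite /= compmA. Qed.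

Fact comod_comp1m X Y (f : comod_hom X Y) :
  comod_comp (mk_comod_hom (comod_idP Y)) f = f.
Proof. by apply: val_inj; rewrite /= comp1m. Qed.

Fact comod_compm1 X Y (f : comod_hom X Y) :
  comod_comp f (mk_comod_hom (comod_idP X)) = f.
Proof. by apply: val_inj; rewrite /= compm1. Qed.

Fact comod_comp_linl X Y Z (f : comod_hom X Y) :
  linear (fun g : comod_hom Y Z => comod_comp g f).
Proof. by move=> c g h; apply: val_inj; rewrite /= comp_linl. Qed.

Fact comod_comp_linr X Y Z (g : comod_hom Y Z) :
  linear (fun f : comod_hom X Y => comod_comp g f).
Proof. by move=> c f h; apply: val_inj; rewrite /= comp_linr. Qed.

Definition Comod : lincat k :=
  LinCat comod_compA comod_comp1m comod_compm1 comod_comp_linl comod_comp_linr.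

Variables (eta : mor (munit C) N) (etaP : is_coalg_hom (A := unit_coalgebra) eta).

Fact triv_coactA (M : C) :
  asc _ _ _ \co (comul N \om idm _) \co ((eta \om idm M) \co lunV M)
  = (idm _ \om ((eta \om idm M) \co lunV M)) \co ((eta \om idm M) \co lunV M).
Proof.
rewrite compmA -(compmA (asc _ _ _)) -tens_comp1.
rewrite etaP.1 tens_comp1 /= (compmA (asc _ _ _)) asc_nat.
rewrite -(compmA _ (asc _ _ _)) asc_lunV -tens_comp compm1.
by rewrite [RHS]compmA -tens_comp comp1m compm1.
Qed.

Fact triv_coact1 (M : C) :
  lun _ \co (counit N \om idm _) \co ((eta \om idm M) \co lunV M) = idm M.
Proof.
rewrite compmA -(compmA (lun M)) -tens_comp1.
by rewrite etaP.2 /= tens_id compm1 lunVK.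
Qed.

Definition triv_comod (M : C) : comodule N :=
  Comodule (triv_coactA M) (triv_coact1 M).

End Comod.
End Comodules.

Arguments triv_comod {k C N eta} etaP M.

Section CSplit.
Variables (k : fieldType) (C : moncat k) (N : coalgebra C).
Implicit Types X Y T W : comodule N.

(* The underlying extension in C is isomorphic, as an extension, to
   Y -> Y (+) X -> X. *)
Definition csplit X Y (E : extension (X : Comod N) (Y : Comod N)) : Prop :=
  exists (B : biproduct (Y : C) (X : C))
         (h : mor (comod_ob (ext_ob E)) (bp_ob B)),
    [/\ is_iso h,
        h \co comod_hom_val (ext_i E) = injl B
      & prr B \co h = comod_hom_val (ext_p E)].

Record csplit_ext X Y := CSplitExt {
  csplit_val :> extension (X : Comod N) (Y : Comod N);
  csplitP : csplit csplit_val }.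

HB.instance Definition _ X Y := gen_eqMixin (csplit_ext X Y).
HB.instance Definition _ X Y := gen_choiceMixin (csplit_ext X Y).

Definition csplit_equiv X Y : rel (csplit_ext X Y) :=
  fun E E' => `[< ext_equiv E E' >].

Fact csplit_equiv_is_equiv X Y : equiv_class_of (@csplit_equiv X Y).
Proof.
split=> [E|E E'|E' E E''].
- by apply/asboolP; apply: ext_equiv_refl.
- by apply/asboolP/asboolP; apply: ext_equiv_sym.
- by move=> /asboolP e /asboolP e'; apply/asboolP; apply: ext_equiv_trans e e'.
Qed.

Canonical csplit_equiv_equiv X Y := EquivRelPack (csplit_equiv_is_equiv X Y).

(* Ext^1_{Comod(N), C split}(X, Y) *)
Definition ext1_csplit X Y := {eq_quot @csplit_equiv X Y}.
HB.instance Definition _ X Y := Choice.on (ext1_csplit X Y).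
HB.instance Definition _ X Y := EqQuotient.on (ext1_csplit X Y).

End CSplit.

(* The k-vector space structure on C-split extension classes. The Baer sum and
   the scalar multiples of C-split extensions are shown to exist by means of
   the extensions tw z: Y (+) X with the coaction of the direct sum twisted by
   z : X -> N \ox Y. *)
Section Twist.
Variables (k : fieldType) (C : moncat k) (N : coalgebra C).
Implicit Types X Y T W : comodule N.

Lemma comul_nat (U V : C) (f : mor U V) :
  asc N N V \co (comul N \om idm V) \co (idm N \om f)
  = (idm N \om (idm N \om f)) \co (asc N N U \co (comul N \om idm U)).
Proof.
by rewrite -compmA tens_swap compmA -tens_id asc_nat -compmA.
Qed.

Lemma counit_nat (U V : C) (f : mor U V) :
  lun V \co (counit N \om idm V) \co (idm N \om f)
  = f \co (lun U \co (counit N \om idm U)).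
Proof. by rewrite -compmA tens_swap compmA lun_nat -compmA. Qed.

Definition cocycle X Y (z : mor X (N \ox Y)) : Prop :=
  asc N N Y \co (comul N \om idm Y) \co z
    = (idm N \om coact Y) \co z + (idm N \om z) \co coact X
  /\ lun Y \co (counit N \om idm Y) \co z = 0.

Section Tw.
Variables (X Y : comodule N) (z : mor X (N \ox Y)) (zP : cocycle z).
Variable (B : biproduct (Y : C) (X : C)).

Definition tw_coact : mor B (N \ox B) :=
  (idm N \om injl B) \co (coact Y \co prl B + z \co prr B)
  + (idm N \om injr B) \co (coact X \co prr B).

Lemma tw_coact_l : tw_coact \co injl B = (idm N \om injl B) \co coact Y.
Proof.
rewrite /tw_coact !compDl -!compmA !compDl -!compmA prl_injl prr_injl.
by rewrite !compm0 !addr0 compm1.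
Qed.

Lemma tw_coact_r :
  tw_coact \co injr B = (idm N \om injl B) \co z + (idm N \om injr B) \co coact X.
Proof.
rewrite /tw_coact !compDl -!compmA !compDl -!compmA prl_injr prr_injr.
by rewrite !compm0 !add0r !compm1.
Qed.

Lemma bp_joint (W : C) (f g : mor B W) :
  f \co injl B = g \co injl B -> f \co injr B = g \co injr B -> f = g.
Proof.
move=> el er; rewrite -(compm1 f) -(compm1 g) -bp_id !compDr !compmA.
by rewrite el er.
Qed.

Fact tw_coactA : asc _ _ _ \co (comul N \om idm _) \co tw_coact
  = (idm _ \om tw_coact) \co tw_coact.
Proof.
apply: bp_joint.
  rewrite -!compmA tw_coact_l (compmA (asc _ _ _)) (compmA (asc _ _ _ \co _)).
  rewrite comul_nat -!compmA (compmA (asc _ _ _)) coactA.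
  by rewrite !compmA -!tens1_comp tw_coact_l.
rewrite -!compmA tw_coact_r !compDr !compmA !comul_nat -!tens1_comp.
rewrite tw_coact_l tw_coact_r tensDr !tens1_comp !compDl.
rewrite -!compmA (compmA (asc _ _ _)) zP.1 (compmA (asc _ _ _)) coactA.
by rewrite compDr addrA.
Qed.

Fact tw_coact1 : lun _ \co (counit N \om idm _) \co tw_coact = idm _.
Proof.
apply: bp_joint; rewrite comp1m.
  rewrite -(compmA _ tw_coact) tw_coact_l (compmA (lun _ \co _)) counit_nat.
  by rewrite -(compmA (injl B)) coact1 compm1.
rewrite -(compmA _ tw_coact) tw_coact_r compDr !(compmA (lun _ \co _)).
rewrite !counit_nat -(compmA (injl B)) zP.2 compm0 add0r.
by rewrite -(compmA (injr B)) coact1 compm1.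
Qed.

Definition tw : comodule N := Comodule tw_coactA tw_coact1.

Lemma tw_mapP T (f : mor T B) :
  coact X \co (prr B \co f) = (idm N \om (prr B \co f)) \co coact T ->
  coact Y \co (prl B \co f) + z \co (prr B \co f)
    = (idm N \om (prl B \co f)) \co coact T ->
  coact tw \co f = (idm N \om f) \co coact T.
Proof.
move=> er el; rewrite /= /tw_coact.
have ef : f = injl B \co (prl B \co f) + injr B \co (prr B \co f).
  by rewrite !compmA -compDl bp_id comp1m.
rewrite {2}ef tensDr [RHS]compDl !(tens1_comp _ (injl B)) !(tens1_comp _ (injr B)).
rewrite -(compmA (idm N \om injl B)) -(compmA (idm N \om injr B)).
by rewrite -el -er !compDl -!compmA !compDl -!compmA.
Qed.

Lemma tw_map_r T (f : comod_hom T tw) :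
  coact X \co (prr B \co (f : mor T B))
  = (idm N \om (prr B \co (f : mor T B))) \co coact T.
Proof.
have e : tw_coact \co (f : mor T B) = (idm N \om (f : mor T B)) \co coact T.
  exact: comod_homE f.
rewrite tens1_comp -compmA -e /tw_coact.
rewrite !(compDl, compDr) !compmA -!tens1_comp prr_injl prr_injr.
by rewrite tensm0 tens_id !comp0m !add0r comp1m.
Qed.

Lemma tw_map_l T (f : comod_hom T tw) :
  coact Y \co (prl B \co (f : mor T B)) + z \co (prr B \co (f : mor T B))
  = (idm N \om (prl B \co (f : mor T B))) \co coact T.
Proof.
have e : tw_coact \co (f : mor T B) = (idm N \om (f : mor T B)) \co coact T.
  exact: comod_homE f.
rewrite tens1_comp -compmA -e /tw_coact.
rewrite !(compDl, compDr) !compmA -!tens1_comp prl_injl prl_injr.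
by rewrite tensm0 tens_id !comp0m addr0 !comp1m.
Qed.

End Tw.
End Twist.

Section TwExt.
Variables (k : fieldType) (C : moncat k) (N : coalgebra C).
Implicit Types X Y T W : comodule N.

Lemma cval_comp X Y W (g : mor (Y : Comod N) (W : Comod N))
    (f : mor (X : Comod N) (Y : Comod N)) :
  comod_hom_val (g \co f) = comod_hom_val g \co comod_hom_val f.
Proof. by []. Qed.

Lemma cval_id X : comod_hom_val (idm (X : Comod N)) = idm (X : C).
Proof. by []. Qed.

Lemma cval0 X Y : comod_hom_val (0 : mor (X : Comod N) (Y : Comod N)) = 0.
Proof. by []. Qed.

Lemma cvalB X Y (f g : mor (X : Comod N) (Y : Comod N)) :
  comod_hom_val (f - g) = comod_hom_val f - comod_hom_val g.
Proof. by []. Qed.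

Lemma cvalZ X Y (c : k) (f : mor (X : Comod N) (Y : Comod N)) :
  comod_hom_val (c *: f) = c *: comod_hom_val f.
Proof. by []. Qed.

Lemma cvalE X Y (f : mor (X : Comod N) (Y : Comod N)) :
  coact Y \co comod_hom_val f = (idm N \om comod_hom_val f) \co coact X.
Proof. exact: comod_homE. Qed.

Definition comod_mor X Y (f : mor (X : C) (Y : C))
    (e : coact Y \co f = (idm N \om f) \co coact X)
  : mor (X : Comod N) (Y : Comod N) := mk_comod_hom e.
Arguments comod_mor X Y {f} e.

Section Tw.
Variables (X Y : comodule N) (z : mor X (N \ox Y)) (zP : cocycle z).
Variable (B : biproduct (Y : C) (X : C)).
Let E := tw zP B.

Fact tw_iP : coact E \co injl B = (idm N \om injl B) \co coact Y.
Proof. exact: tw_coact_l. Qed.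

Fact tw_pP : coact X \co prr B = (idm N \om prr B) \co coact E.
Proof.
have := tw_map_r (idm (E : Comod N) : comod_hom E E).
by rewrite /= !compm1.
Qed.

Fact tw_lP : coact Y \co prl B + z \co prr B = (idm N \om prl B) \co coact E.
Proof.
have := tw_map_l (idm (E : Comod N) : comod_hom E E).
by rewrite /= !compm1.
Qed.

Definition tw_i : mor (Y : Comod N) (E : Comod N) := comod_mor Y E tw_iP.
Definition tw_p : mor (E : Comod N) (X : Comod N) := comod_mor E X tw_pP.

Fact tw_kernel : is_kernel tw_i tw_p.
Proof.
split; first by apply: val_inj; rewrite /= prr_injl.
move=> T t pt; have {}pt : prr B \co comod_hom_val t = 0.
  by have := congr1 (@comod_hom_val _ _ _ _ _) pt.
have e : coact Y \co (prl B \co comod_hom_val t)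
    = (idm N \om (prl B \co comod_hom_val t)) \co coact T.
  have := tw_map_l (t : comod_hom T E); rewrite pt compm0 addr0; exact.
exists (comod_mor T Y e); split.
  apply: val_inj; rewrite /= -[RHS]comp1m -bp_id compDl.
  by rewrite -!compmA pt compm0 addr0.
move=> u iu; apply: val_inj => /=.
have <- : injl B \co comod_hom_val u = comod_hom_val t.
  by have := congr1 (@comod_hom_val _ _ _ _ _) iu.
by rewrite compmA prl_injl comp1m.
Qed.

Fact tw_cokernel : is_cokernel tw_p tw_i.
Proof.
split; first by apply: val_inj; rewrite /= prr_injl.
move=> T t it; have {}it : comod_hom_val t \co injl B = 0.
  by have := congr1 (@comod_hom_val _ _ _ _ _) it.
have e : coact T \co (comod_hom_val t \co injr B)
    = (idm N \om (comod_hom_val t \co injr B)) \co coact X.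
  rewrite compmA cvalE -compmA tw_coact_r compDr !compmA -!tens1_comp it tensm0.
  by rewrite comp0m add0r.
exists (comod_mor X T e); split.
  apply: val_inj; rewrite /= -[RHS]compm1 -bp_id compDr.
  by rewrite !compmA it comp0m add0r.
move=> u pu; apply: val_inj => /=.
have <- : comod_hom_val u \co prr B = comod_hom_val t.
  by have := congr1 (@comod_hom_val _ _ _ _ _) pu.
by rewrite -compmA prr_injr compm1.
Qed.

Definition tw_ext0 : extension (X : Comod N) (Y : Comod N) :=
  Extension tw_kernel tw_cokernel.

Fact tw_csplit : csplit tw_ext0.
Proof.
exists B, (idm (bp_ob B)); split; last by rewrite compm1.
  by exists (idm (bp_ob B)); rewrite comp1m.
by rewrite comp1m.
Qed.

Definition tw_ext : csplit_ext X Y := CSplitExt tw_csplit.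

End Tw.

Lemma csplit_tw X Y (E : csplit_ext X Y) :
  exists (z : mor X (N \ox Y)) (zP : cocycle z) (B : biproduct (Y : C) (X : C)),
    ext_equiv E (tw_ext zP B).
Proof.
case: E => E cs; have [B [h [[g [gh hg]] hi0 hp0]]] := cs.
pose i := comod_hom_val (ext_i E); pose p := comod_hom_val (ext_p E).
have hi : h \co i = injl B := hi0; have hp : prr B \co h = p := hp0.
have gl : g \co injl B = i by rewrite -hi compmA gh comp1m.
have pg : p \co g = prr B by rewrite -hp -compmA hg compm1.
pose r := prl B \co h; pose s := g \co injr B.
have ri : r \co i = idm _ by rewrite -compmA hi prl_injl.
have ps : p \co s = idm _ by rewrite compmA pg prr_injr.
have rs : r \co s = 0 by rewrite -compmA (compmA h) hg comp1m prl_injr.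
have pi : p \co i = 0.
  by have := congr1 (@comod_hom_val _ _ _ _ _) (ext_ker E).1.
have iE : i \co r + s \co p = idm _.
  by rewrite -gl -hp -!compmA -compDr !compmA -compDl bp_id comp1m.
pose z := (idm N \om r) \co (coact (ext_ob E : comodule N) \co s).
have rho : (idm N \om r) \co coact (ext_ob E : comodule N)
         = coact Y \co r + z \co p.
  rewrite -[LHS]compm1 -iE compDr !compmA; congr (_ + _); last first.
    by rewrite /z !compmA.
  rewrite -(compmA (idm N \om r)) cvalE !compmA -tens1_comp ri tens_id.
  by rewrite comp1m.
have zP : cocycle z.
  split.
    rewrite /z compmA comul_nat -!compmA (compmA (asc _ _ _)) (compmA (_ \co _) _ s).
    rewrite coactA -(compmA (_ \om coact _)) (compmA (_ \om (_ \om _))).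
    rewrite -tens1_comp rho tensDr compDl; congr (_ + _).
      by rewrite tens1_comp -!compmA.
    rewrite tens1_comp -!compmA; congr (_ \co _).
    by rewrite compmA -cvalE -compmA ps compm1.
  rewrite /z compmA counit_nat -compmA (compmA (lun _ \co _)) coact1.
  by rewrite comp1m rs.
exists z, zP, B.
have e : coact (tw zP B) \co h = (idm N \om h) \co coact (ext_ob E : comodule N).
  apply: tw_mapP; first by rewrite hp cvalE.
  by rewrite hp rho.
have e' : coact (ext_ob E : comodule N) \co g = (idm N \om g) \co coact (tw zP B).
  rewrite -[LHS]comp1m -tens_id -gh tens1_comp -!compmA; congr (_ \co _).
  by rewrite compmA -e -compmA hg compm1.
exists (comod_mor (ext_ob E) (tw zP B) e); split.
- exists (comod_mor (tw zP B) (ext_ob E) e').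
  by split; apply: val_inj.
- by apply: val_inj; rewrite /= hi.
- by apply: val_inj; rewrite /= hp.
Qed.

Lemma cocycle0 X Y : cocycle (0 : mor X (N \ox Y)).
Proof. by split; rewrite ?tensm0 !compm0 ?comp0m ?addr0. Qed.

Lemma cocycleD X Y (z w : mor X (N \ox Y)) :
  cocycle z -> cocycle w -> cocycle (z + w).
Proof.
move=> [z1 z2] [w1 w2]; split; last by rewrite compDr z2 w2 addr0.
by rewrite !compDr tensDr compDl z1 w1 addrACA.
Qed.

Lemma cocycleZ X Y (c : k) (z : mor X (N \ox Y)) :
  cocycle z -> cocycle (c *: z).
Proof.
move=> [z1 z2]; split; last by rewrite compZr z2 scaler0.
by rewrite !compZr tensZr compZl z1 scalerDr.
Qed.

Lemma cocycle_comp X X' Y (z : mor X (N \ox Y))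
    (f : mor (X' : Comod N) (X : Comod N)) :
  cocycle z -> cocycle (z \co comod_hom_val f).
Proof.
move=> [z1 z2]; split; last by rewrite compmA z2 comp0m.
rewrite compmA z1 compDl tens1_comp -!compmA; congr (_ + _ \co _).
exact: cvalE.
Qed.

Lemma tw_baer X Y (z w : mor X (N \ox Y)) (zP : cocycle z) (wP : cocycle w)
    (zwP : cocycle (z + w)) (B1 B2 B3 : biproduct (Y : C) (X : C)) :
  is_baer_sum (tw_ext zP B1) (tw_ext wP B2) (tw_ext zwP B3).
Proof.
pose E1 := tw zP B1; pose E2 := tw wP B2; pose E3 := tw zwP B3.
pose p1 : mor (E1 : Comod N) (X : Comod N) := tw_p zP B1.
pose vP := cocycle_comp p1 wP.
have [_ /(_ Y E1) [BP] _ _ _] := cat_abelian C.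
pose P := tw vP BP.
pose q1 : mor (P : Comod N) (E1 : Comod N) := tw_p vP BP.
pose q2m := injl B2 \co prl BP + injr B2 \co (prr B1 \co prr BP).
have q2P : coact E2 \co q2m = (idm N \om q2m) \co coact P.
  have er : prr B2 \co q2m = prr B1 \co prr BP.
    by rewrite compDr !compmA prr_injl prr_injr comp0m add0r comp1m.
  have el : prl B2 \co q2m = prl BP.
    by rewrite compDr !compmA prl_injl prl_injr !comp0m addr0 comp1m.
  apply: (@tw_mapP _ _ _ _ _ _ wP B2 P q2m); rewrite er ?el.
    exact: (cvalE (p1 \co q1)).
  by rewrite compmA; exact: (tw_lP vP BP).
pose q2 : mor (P : Comod N) (E2 : Comod N) := comod_mor P E2 q2P.
pose am := injr BP \co injl B1.
pose bm := injl BP.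
have ar : prr BP \co am = injl B1 by rewrite /am compmA prr_injr comp1m.
have al : prl BP \co am = 0 by rewrite /am compmA prl_injr comp0m.
have aP : coact P \co am = (idm N \om am) \co coact Y.
  apply: (@tw_mapP _ _ _ _ _ _ vP BP Y am); rewrite ar ?al.
    exact: (cvalE (tw_i zP B1)).
  by rewrite -(compmA w) /= prr_injl !compm0 tensm0 comp0m addr0.
pose a : mor (Y : Comod N) (P : Comod N) := comod_mor Y P aP.
pose b : mor (Y : Comod N) (P : Comod N) := tw_i vP BP.
pose hm := injl B3 \co (prl BP + prl B1 \co prr BP)
           + injr B3 \co (prr B1 \co prr BP).
have hr : prr B3 \co hm = prr B1 \co prr BP.
  by rewrite compDr !compmA prr_injl prr_injr comp0m add0r comp1m.
have hl : prl B3 \co hm = prl BP + prl B1 \co prr BP.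
  by rewrite compDr !compmA prl_injl prl_injr !comp0m addr0 comp1m.
have hP : coact E3 \co hm = (idm N \om hm) \co coact P.
  apply: (@tw_mapP _ _ _ _ _ _ zwP B3 P hm); rewrite hr ?hl.
    exact: (cvalE (p1 \co q1)).
  have lP : coact Y \co prl BP + (w \co prr B1) \co prr BP
            = (idm N \om prl BP) \co coact P := tw_lP vP BP.
  have pP : coact E1 \co prr BP = (idm N \om prr BP) \co coact P := tw_pP vP BP.
  have lE : coact Y \co prl B1 + z \co prr B1
            = (idm N \om prl B1) \co coact E1 := tw_lP zP B1.
  rewrite tensDr [RHS]compDl -lP tens1_comp -(compmA (idm N \om prl B1)) -pP.
  rewrite (compmA (idm N \om prl B1)) -lE compDr !compDl !compmA.
  by rewrite (addrC (z \co _ \co _)) addrACA.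
pose h : mor (P : Comod N) (E3 : Comod N) := comod_mor P E3 hP.
exists P, q1, q2, a, b, h; split.
- split.
    apply: val_inj; rewrite /= compDr !compmA prr_injl prr_injr comp0m add0r.
    by rewrite comp1m.
  move=> T t1 t2 et.
  have {}et : prr B1 \co comod_hom_val t1 = prr B2 \co comod_hom_val t2.
    by have := congr1 (@comod_hom_val _ _ _ _ _) et.
  pose um := injl BP \co (prl B2 \co comod_hom_val t2)
             + injr BP \co comod_hom_val t1.
  have ur : prr BP \co um = comod_hom_val t1.
    by rewrite compDr !compmA prr_injl prr_injr !comp0m add0r comp1m.
  have ul : prl BP \co um = prl B2 \co comod_hom_val t2.
    by rewrite compDr !compmA prl_injl prl_injr !comp0m addr0 comp1m.
  have uP : coact P \co um = (idm N \om um) \co coact T.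
    apply: tw_mapP; rewrite ur ?ul; first exact: cvalE.
    by rewrite -compmA /= et; exact: (tw_map_l (t2 : comod_hom T E2)).
  exists (comod_mor T P uP); split.
    split; apply: val_inj; rewrite /= ?ur //.
    rewrite compDl -!compmA ur ul et !compmA -compDl bp_id.
    by rewrite comp1m.
  move=> v [v1 v2]; apply: val_inj => /=.
  have w1 : prr BP \co comod_hom_val v = comod_hom_val t1.
    by have := congr1 (@comod_hom_val _ _ _ _ _) v1.
  have w2 : q2m \co comod_hom_val v = comod_hom_val t2.
    by have := congr1 (@comod_hom_val _ _ _ _ _) v2.
  rewrite -[RHS]comp1m -bp_id compDl /um -w2 -w1 -!compmA; congr (_ \co _ + _).
  rewrite compmA /q2m compDr !compmA prl_injl prl_injr !comp0m addr0.
  by rewrite comp1m.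
- split; apply: val_inj; rewrite /=.
    by rewrite /am compmA prr_injr comp1m.
  rewrite /q2m /am compDl -!compmA (compmA (prl BP)) (compmA (prr BP)).
  by rewrite prl_injr prr_injr comp1m prr_injl comp0m !compm0 addr0.
- split; apply: val_inj; rewrite /=; first by rewrite /bm prr_injl.
  by rewrite /q2m compDl -!compmA prl_injl prr_injl !compm0 compm1 addr0.
- have ha : hm \co am = injl B3.
    rewrite /hm /am compDl -!compmA compDl -!compmA (compmA (prl BP)).
    rewrite !(compmA (prr BP)) prl_injr prr_injr comp1m comp0m add0r.
    by rewrite prl_injl prr_injl !compm0 addr0 compm1.
  have hb : hm \co injl BP = injl B3.
    rewrite /hm compDl -!compmA compDl -!compmA prl_injl prr_injl.
    by rewrite !compm0 !addr0 compm1.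
  split; first by apply: val_inj; rewrite /= compDr compNr ha hb subrr.
  move=> T t et.
  have {}et : comod_hom_val t \co am = comod_hom_val t \co injl BP.
    apply/eqP; rewrite -subr_eq0 -compNr -compDr; apply/eqP.
    by have := congr1 (@comod_hom_val _ _ _ _ _) et.
  pose sec := injl BP \co prl B3 + injr BP \co (injr B1 \co prr B3).
  have hsec : hm \co sec = idm _.
    rewrite compDr !compmA hb -bp_id; congr (_ + _ \co _).
    rewrite /hm !compDl -!compmA !compDl -!compmA !(compmA (prr BP)) (compmA (prl BP)).
    rewrite prl_injr prr_injr comp0m !comp1m prl_injr prr_injr.
    by rewrite addr0 compm0 add0r compm1.
  pose um := comod_hom_val t \co sec.
  have uh : um \co hm = comod_hom_val t.
    have sh : sec \co hm = injl BP \co (prl BP + prl B1 \co prr BP)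
              + injr BP \co (injr B1 \co (prr B1 \co prr BP)).
      by rewrite /sec compDl -!compmA hr hl.
    have e1 : idm (bp_ob BP) = injl BP \co prl BP
              + injr BP \co (injl B1 \co (prl B1 \co prr BP))
              + injr BP \co (injr B1 \co (prr B1 \co prr BP)).
      rewrite -addrA -compDr !(compmA _ _ (prr BP)) -compDl bp_id.
      by rewrite comp1m bp_id.
    rewrite -[RHS]compm1 e1 -compmA sh !compDr; congr (_ + _); congr (_ + _).
    by rewrite !compmA -(compmA _ (injr BP) (injl B1)) -/am et.
  have uP : coact T \co um = (idm N \om um) \co coact E3.
    have main : (coact T \co um) \co hm = ((idm N \om um) \co coact E3) \co hm.
      rewrite -(compmA (coact T) um hm) uh -(compmA (idm N \om um)) hP.
      rewrite (compmA (idm N \om um)) -tens1_comp uh; exact: (cvalE t).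
    rewrite -[LHS]compm1 -[RHS]compm1 -hsec (compmA (coact T \co um)) main.
    by rewrite -compmA.
  exists (comod_mor E3 T uP); split; first by apply: val_inj.
  move=> v vh; apply: val_inj => /=.
  have vh' : comod_hom_val v \co hm = comod_hom_val t.
    by have := congr1 (@comod_hom_val _ _ _ _ _) vh.
  by rewrite /um -vh' -compmA hsec compm1.
- split; apply: val_inj; rewrite /= ?hr //.
  rewrite /hm /am compDl -!compmA compDl -!compmA (compmA (prl BP)).
  rewrite !(compmA (prr BP)) prl_injr prr_injr comp1m comp0m add0r.
  by rewrite prl_injl prr_injl !compm0 addr0 compm1.
Qed.

Lemma tw_scale (c : k) X Y (z : mor X (N \ox Y)) (zP : cocycle z)
    (czP : cocycle (c *: z)) (B B' : biproduct (Y : C) (X : C)) :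
  is_ext_scale c (tw_ext zP B) (tw_ext czP B').
Proof.
pose hm := injl B' \co (c *: prl B) + injr B' \co prr B.
have hr : prr B' \co hm = prr B.
  by rewrite compDr !compmA prr_injl prr_injr comp0m add0r comp1m.
have hl : prl B' \co hm = c *: prl B.
  by rewrite compDr !compmA prl_injl prl_injr !comp0m addr0 comp1m.
have hP : coact (tw czP B') \co hm = (idm N \om hm) \co coact (tw zP B).
  apply: (@tw_mapP _ _ _ _ _ _ czP B' (tw zP B) hm); rewrite hr ?hl; first exact: tw_pP.
  by rewrite tensZr !compZl -tw_lP scalerDr compZr.
exists (comod_mor (tw zP B) (tw czP B') hP).
split; last by apply: val_inj; rewrite /= hr.
have hi : hm \co injl B = c *: injl B'.
  rewrite compDl -!compmA compZl prl_injl prr_injl compm0 addr0.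
  by rewrite compZr compm1.
have hj : hm \co injr B = injr B'.
  rewrite compDl -!compmA compZl prl_injr prr_injr scaler0 compm0 add0r.
  by rewrite compm1.
split; first by apply: val_inj; rewrite /= hi compZr compm1.
move=> T t g e.
have {}e : comod_hom_val t \co injl B = c *: comod_hom_val g.
  have := congr1 (@comod_hom_val _ _ _ _ _) e.
  by rewrite /= compZr compm1.
pose um := comod_hom_val g \co prl B' + comod_hom_val t \co injr B \co prr B'.
have ui : um \co injl B' = comod_hom_val g.
  by rewrite compDl -!compmA prl_injl prr_injl !compm0 addr0 compm1.
have uj : um \co injr B' = comod_hom_val t \co injr B.
  by rewrite compDl -!compmA prl_injr prr_injr !compm0 add0r compm1.
have uP : coact T \co um = (idm N \om um) \co coact (tw czP B').
  apply: bp_joint; rewrite -!compmA.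
    rewrite ui (tw_iP czP B') compmA -tens1_comp ui; exact: cvalE.
  rewrite uj tw_coact_r compDr !compmA -!tens1_comp ui uj cvalE.
  rewrite -compmA tw_coact_r compDr !compmA -!tens1_comp e.
  by rewrite tensZr compZl compZr.
exists (comod_mor (tw czP B') T uP); split.
  split; apply: val_inj => //=.
  apply: bp_joint; rewrite -compmA; last by rewrite hj uj.
  by rewrite hi compZr ui e.
move=> v [v1 v2]; apply: val_inj => /=.
have w1 : comod_hom_val v \co hm = comod_hom_val t.
  by have := congr1 (@comod_hom_val _ _ _ _ _) v1.
have w2 : comod_hom_val v \co injl B' = comod_hom_val g.
  by have := congr1 (@comod_hom_val _ _ _ _ _) v2.
apply: bp_joint; first by rewrite ui w2.
by rewrite uj -hj compmA w1.
Qed.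

End TwExt.

Section Ext1.
Variables (k : fieldType) (C : moncat k) (N : coalgebra C).
Variables X Y : comodule N.

Fact biproduct_inh : exists _ : biproduct (Y : C) (X : C), True.
Proof. by have [_ /(_ Y X) [B] _ _ _] := cat_abelian C; exists B. Qed.

Definition some_biproduct : biproduct (Y : C) (X : C) := sval (cid biproduct_inh).

Fact baer_sum_exists (E1 E2 : csplit_ext X Y) :
  exists E : csplit_ext X Y, is_baer_sum E1 E2 E.
Proof.
have [z [zP [B e]]] := csplit_tw E1; have [w [wP [B' e']]] := csplit_tw E2.
exists (tw_ext (cocycleD zP wP) B).
by apply: baer_sum_transport (tw_baer _ _ _ B B' B); apply: ext_equiv_sym;
  eassumption.
Qed.

Fact ext_scale_exists (c : k) (E : csplit_ext X Y) :
  exists E' : csplit_ext X Y, is_ext_scale c E E'.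
Proof.
have [z [zP [B e]]] := csplit_tw E; exists (tw_ext (cocycleZ c zP) B).
by apply: ext_scale_transport (tw_scale zP _ B B); apply: ext_equiv_sym.
Qed.

Local Notation ext1 := (ext1_csplit X Y).

Definition ext1_add (A B : ext1) : ext1 :=
  \pi_(ext1_csplit X Y) (sval (cid (baer_sum_exists (repr A) (repr B)))).
Definition ext1_scale (c : k) (A : ext1) : ext1 :=
  \pi_(ext1_csplit X Y) (sval (cid (ext_scale_exists c (repr A)))).
Definition ext1_opp (A : ext1) : ext1 := ext1_scale (-1) A.
(* The direct sum of the comodules Y and X. *)
Definition ext1_zero : ext1 := \pi_(ext1_csplit X Y) (tw_ext (cocycle0 X Y) some_biproduct).

Lemma pi_ext1 (E E' : csplit_ext X Y) :
  \pi_(ext1_csplit X Y) E = \pi_(ext1_csplit X Y) E' <-> ext_equiv E E'.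
Proof.
by split=> [/eqmodP/asboolP|e] //; apply/eqmodP/asboolP.
Qed.

Lemma repr_ext1 (E : csplit_ext X Y) : ext_equiv E (repr (\pi_(ext1_csplit X Y) E)).
Proof. by apply/pi_ext1; rewrite reprK. Qed.

Lemma ext1_addP (E1 E2 E : csplit_ext X Y) : is_baer_sum E1 E2 E ->
  ext1_add (\pi_(ext1_csplit X Y) E1) (\pi_(ext1_csplit X Y) E2) = \pi_(ext1_csplit X Y) E.
Proof.
move=> s; apply/pi_ext1; case: cid => F /= sF; apply: baer_sum_unique sF _.
by apply: baer_sum_transport s; apply: repr_ext1.
Qed.

Lemma ext1_scaleP c (E E' : csplit_ext X Y) : is_ext_scale c E E' ->
  ext1_scale c (\pi_(ext1_csplit X Y) E) = \pi_(ext1_csplit X Y) E'.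
Proof.
move=> s; apply/pi_ext1; case: cid => F /= sF; apply: ext_scale_unique sF _.
by apply: ext_scale_transport s; apply: repr_ext1.
Qed.

Lemma tw_congr (z w : mor X (N \ox Y)) (zP : cocycle z) (wP : cocycle w)
    (B : biproduct (Y : C) (X : C)) :
  z = w -> \pi_(ext1_csplit X Y) (tw_ext zP B) = \pi_(ext1_csplit X Y) (tw_ext wP B).
Proof. by move=> e; subst w; rewrite (Prop_irrelevance zP wP). Qed.

Lemma ext1_tw (A : ext1) :
  exists (z : mor X (N \ox Y)) (zP : cocycle z) (B : biproduct (Y : C) (X : C)),
    A = \pi_(ext1_csplit X Y) (tw_ext zP B).
Proof.
have [z [zP [B e]]] := csplit_tw (repr A); exists z, zP, B.
by rewrite -[LHS]reprK; apply/pi_ext1.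
Qed.

Lemma ext1_addE (z w : mor X (N \ox Y)) (zP : cocycle z) (wP : cocycle w) B B' B'' :
  ext1_add (\pi_(ext1_csplit X Y) (tw_ext zP B)) (\pi_(ext1_csplit X Y) (tw_ext wP B'))
  = \pi_(ext1_csplit X Y) (tw_ext (cocycleD zP wP) B'').
Proof. exact/ext1_addP/tw_baer. Qed.

Lemma ext1_scaleE c (z : mor X (N \ox Y)) (zP : cocycle z) B B' :
  ext1_scale c (\pi_(ext1_csplit X Y) (tw_ext zP B)) = \pi_(ext1_csplit X Y) (tw_ext (cocycleZ c zP) B').
Proof. exact/ext1_scaleP/tw_scale. Qed.

Fact ext1_addA : associative ext1_add.
Proof.
move=> A B D; have [z [zP [b ->]]] := ext1_tw A.
have [w [wP [b' ->]]] := ext1_tw B; have [v [vP [b'' ->]]] := ext1_tw D.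
rewrite !(ext1_addE _ _ _ _ b); exact/tw_congr/addrA.
Qed.

Fact ext1_addC : commutative ext1_add.
Proof.
move=> A B; have [z [zP [b ->]]] := ext1_tw A.
have [w [wP [b' ->]]] := ext1_tw B.
rewrite !(ext1_addE _ _ _ _ b); exact/tw_congr/addrC.
Qed.

Fact ext1_add0 : left_id ext1_zero ext1_add.
Proof.
move=> A; have [z [zP [b ->]]] := ext1_tw A.
rewrite (ext1_addE _ _ _ _ b); exact/tw_congr/add0r.
Qed.

Fact ext1_addN : left_inverse ext1_zero ext1_opp ext1_add.
Proof.
move=> A; have [z [zP [b ->]]] := ext1_tw A.
rewrite /ext1_opp (ext1_scaleE _ _ _ b) (ext1_addE _ _ _ _ some_biproduct).
by apply: tw_congr; rewrite scaleN1r addNr.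
Qed.

Fact ext1_scaleA a b (A : ext1) :
  ext1_scale a (ext1_scale b A) = ext1_scale (a * b) A.
Proof.
have [z [zP [B ->]]] := ext1_tw A.
rewrite !(ext1_scaleE _ _ _ B); exact/tw_congr/scalerA.
Qed.

Fact ext1_scale1 : left_id 1 ext1_scale.
Proof.
move=> A; have [z [zP [B ->]]] := ext1_tw A.
rewrite !(ext1_scaleE _ _ _ B); exact/tw_congr/scale1r.
Qed.

Fact ext1_scaleDr : right_distributive ext1_scale ext1_add.
Proof.
move=> c A D; have [z [zP [b ->]]] := ext1_tw A.
have [w [wP [b' ->]]] := ext1_tw D.
rewrite !(ext1_addE _ _ _ _ b, ext1_scaleE _ _ _ b); exact/tw_congr/scalerDr.
Qed.

Fact ext1_scaleDl (A : ext1) :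
  {morph ext1_scale^~ A : a b / a + b >-> ext1_add a b}.
Proof.
move=> c d; have [z [zP [b ->]]] := ext1_tw A.
rewrite !(ext1_scaleE _ _ _ b) (ext1_addE _ _ _ _ b); exact/tw_congr/scalerDl.
Qed.

HB.instance Definition _ := GRing.isZmodule.Build ext1
  ext1_addA ext1_addC ext1_add0 ext1_addN.
HB.instance Definition _ := GRing.Zmodule_isLmodule.Build k ext1
  ext1_scaleA ext1_scale1 ext1_scaleDr ext1_scaleDl.

End Ext1.

(* N^prim, as an object of C equipped with its map to N. *)
Definition primitives (k : fieldType) (C : moncat k) (N : coalgebra C)
    (eta : mor (munit C) N) :=
  equalizer (comul N)
    ((idm N \om eta) \co runV N + (eta \om idm N) \co lunV N).

(* Main.v *)
Require Import Defs.
From HB Require Import structures.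
From mathcomp Require Import all_boot all_order all_algebra.
From mathcomp Require Import boolp reals complex.

Set Implicit Arguments.
Unset Strict Implicit.
Unset Printing Implicit Defensive.

Import GRing.Theory.
Local Open Scope ring_scope.
Local Open Scope quotient_scope.

(** A C-split extension of [M_eta] by [1_eta] is a direct sum [1 (+) M] in C
    with an upper triangular coaction, so it is given by one morphism
    [z : M -> N \ox 1], subject to the condition [cocycle z] which expresses
    coassociativity and the counit law.

    For trivial comodules this condition can be read off from the composite
    [d] of [z] with the unit constraint [N \ox 1 -> N]: coassociativity says
    exactly that [Delta \co d = (id \om eta + eta \om id) \co d], and the counit
    law [epsilon \co d = 0] follows from this ([cocycle_primitive]). By the
    universal property of the equalizer, cocycles thus correspond to morphisms
    from [M] to the primitive part.

    Two cocycles give equivalent extensions precisely when they differ by a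
    coboundary [(id \om g) \co coact M - coact 1 \co g] with [g : M -> 1] in C
    ([tw_equiv_coboundary]). Between trivial comodules every morphism of C is
    colinear ([triv_colinear]), so all coboundaries vanish and the cocycle is an
    invariant of the class ([triv_tw_equiv_eq]). As Baer sums and scalar
    multiples add and scale cocycles, the map [prim_ext] from morphisms into
    the primitive part to extension classes is a linear bijection, and its
    inverse is the required isomorphism. *)

Section UnitConstraints.
Variables (k : fieldType) (C : moncat k).
Implicit Types X Y : C.

(** The mirror image of [lun_tens]. Tensoring with the unit on the right is
    faithful, and after tensoring both sides are computed by the triangle for
    the pairs [(X \ox Y, 1)] and [(Y, 1)] and the pentagon. *)
Lemma run_tens X Y :
  (idm X \om run Y) \co asc X Y (munit C) = run (X \ox Y).
Proof.
apply: tens_unit_inj; set I := munit C.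
(* The associator [asc X Y I] is cancelled on the left, which turns the
   equation into one between two sides of the pentagon for [X, Y, I, I]. *)
suff e : asc X Y I \co (((idm X \om run Y) \co asc X Y I) \om idm I)
         = asc X Y I \co (run (X \ox Y) \om idm I).
  by rewrite -[LHS]comp1m -[RHS]comp1m -(ascK X Y I) -!compmA e.
rewrite tens_comp1 compmA asc_nat -!triangle tens1_comp -!compmA.
rewrite (compmA (idm X \om asc _ _ _)) -pentagon !compmA.
by rewrite -asc_nat tens_id -compmA triangle.
Qed.

Lemma runV_inj X Y (f g : mor X Y) : runV Y \co f = runV Y \co g -> f = g.
Proof. by move=> e; rewrite -[f]comp1m -[g]comp1m -(runVK Y) -!compmA e. Qed.

End UnitConstraints.

Section TwistedExtensions.
Variables (k : fieldType) (C : moncat k) (N : coalgebra C).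
Implicit Types X Y : comodule N.

(** In block form with respect to the two biproducts, an
    equivalence of twisted extensions is unitriangular. Its off-diagonal entry
    [g] need not be colinear, and the failure
    [(id \om g) \co coact X - coact Y \co g] is [w - z]. *)
Lemma tw_equiv_coboundary X Y (z w : mor X (N \ox Y)) (zP : cocycle z)
    (wP : cocycle w) (B B' : biproduct (Y : C) (X : C)) :
  ext_equiv (tw_ext zP B) (tw_ext wP B') ->
  exists g : mor (X : C) (Y : C),
    coact Y \co g + w = z + (idm N \om g) \co coact X.
Proof.
case=> h [_ hi hp]; pose hm : mor B B' := comod_hom_val h.
have {}hi : hm \co injl B = injl B'.
  by have := congr1 (@comod_hom_val _ _ _ _ _) hi.
have {}hp : prr B' \co hm = prr B.
  by have := congr1 (@comod_hom_val _ _ _ _ _) hp.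
have e : coact Y \co (prl B' \co hm) + w \co (prr B' \co hm)
         = (idm N \om (prl B' \co hm)) \co tw_coact z B.
  exact: (tw_map_l (h : comod_hom (tw zP B) (tw wP B'))).
exists (prl B' \co hm \co injr B).
have {e} := congr1 (fun f => f \co injr B) e.
rewrite hp compDl -!compmA prr_injr compm1 tw_coact_r => ->.
rewrite compDr; congr (_ + _); rewrite compmA -tens1_comp -compmA //.
by rewrite hi prl_injl tens_id comp1m.
Qed.

(** The class depends only on the cocycle: Baer sums may be formed on any chosen
    biproduct, so adding the zero class changes [B] into [B']. *)
Lemma tw_class_eq X Y (z w : mor X (N \ox Y)) (zP : cocycle z) (wP : cocycle w)
    (B B' : biproduct (Y : C) (X : C)) : z = w ->
  \pi_(ext1_csplit X Y) (tw_ext zP B) = \pi_(ext1_csplit X Y) (tw_ext wP B').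
Proof.
move=> e; rewrite -[LHS]ext1_add0 /ext1_zero (ext1_addE _ _ _ _ B').
by apply: tw_congr; rewrite add0r.
Qed.

End TwistedExtensions.

Section TrivialComodules.
Variables (k : fieldType) (C : moncat k) (N : coalgebra C).
Variables (eta : mor (munit C) N).
Hypothesis etaP : is_coalg_hom (A := unit_coalgebra C) (B := N) eta.
Implicit Types M : C.

Local Notation triv := (triv_comod etaP).
Local Notation one := (munit C).

(** The trivial coaction is natural in the underlying object, by naturality of
    the left unit constraint. *)
Lemma triv_colinear M M' (g : mor M M') :
  coact (triv M') \co g = (idm N \om g) \co coact (triv M).
Proof. by rewrite /= -compmA -lunV_nat !compmA tens_swap. Qed.

(** The coboundary separating two equivalent cocycles is zero here, because its
    off-diagonal entry is colinear. *)
Lemma triv_tw_equiv_eq M M' (z w : mor M (N \ox M'))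
    (zP : cocycle (X := triv M) (Y := triv M') z)
    (wP : cocycle (X := triv M) (Y := triv M') w)
    (B B' : biproduct (M' : C) (M : C)) :
  ext_equiv (tw_ext zP B) (tw_ext wP B') -> z = w.
Proof.
move=> /tw_equiv_coboundary [g]; rewrite triv_colinear addrC => /addIr.
by move->.
Qed.

Definition primitive_mor M (d : mor M N) :=
  comul N \co d
  = ((idm N \om eta) \co runV N + (eta \om idm N) \co lunV N) \co d.

(** Applying [counit \om id] to the defining equation gives
    [d = eta \co counit \co d + d], so [eta \co counit \co d = 0]; and [eta] is
    split monic, with retraction the counit. *)
Lemma counit_primitive M (d : mor M N) : primitive_mor d -> counit N \co d = 0.
Proof.
move=> dP.
have e1 : lun N \co (counit N \om idm N) \co ((idm N \om eta) \co runV N)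
          = eta \co counit N.
  rewrite compmA -(compmA (lun N)) tens_swap compmA lun_nat -!compmA.
  by rewrite runV_nat (compmA (lun _)) -lunV_runV_unit lunVK comp1m.
have e2 : lun N \co (counit N \om idm N) \co ((eta \om idm N) \co lunV N)
          = idm N := triv_coact1 etaP N.
have := congr1 (fun f => lun N \co (counit N \om idm N) \co f) dP.
rewrite /= !compmA counitl comp1m compDr e1 e2 compDl comp1m.
rewrite -[LHS]add0r => /addIr /(congr1 (fun f => counit N \co f)).
by rewrite compm0 -compmA compmA etaP.2 /= comp1m.
Qed.

(** Transporting the cocycle equation along the isomorphism
    [id \om run N : N \ox (N \ox 1) -> N \ox N] turns its three terms into
    the three terms of the equation of a primitive morphism; the normalization
    [counit \co d = 0] is then automatic. *)
Lemma cocycle_primitive M (z : mor M (N \ox one)) :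
  cocycle (X := triv M) (Y := triv one) z <-> primitive_mor (run N \co z).
Proof.
have L : (idm N \om run N) \co (asc N N one \co (comul N \om idm one) \co z)
         = comul N \co (run N \co z).
  by rewrite !compmA run_tens run_nat.
have R1 : (idm N \om run N) \co ((idm N \om coact (triv one)) \co z)
          = (idm N \om eta) \co runV N \co (run N \co z).
  rewrite /= [LHS]compmA -tens1_comp compmA run_nat -compmA -lun_run_unit lunVK.
  by rewrite compm1 -(compmA _ (runV N)) (compmA (runV N)) runK comp1m.
have R2 : (idm N \om run N) \co ((idm N \om z) \co coact (triv M))
          = (eta \om idm N) \co lunV N \co (run N \co z).
  by rewrite compmA -tens1_comp -(triv_colinear (run N \co z)).
split=> [[/(congr1 (fun f => (idm N \om run N) \co f)) e _]|dP].
  by move: e; rewrite /= compDr L R1 R2 /primitive_mor compDl.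
split; last first.
  rewrite lun_run_unit run_nat -compmA.
  exact: counit_primitive.
have inj (f g : mor M (N \ox (N \ox one))) :
    (idm N \om run N) \co f = (idm N \om run N) \co g -> f = g.
  move=> e; rewrite -[f]comp1m -[g]comp1m -tens_id -(runK N) tens1_comp.
  by rewrite -!compmA e.
by apply: inj; rewrite compDr L R1 R2 -compDl.
Qed.

Variables (P : primitives eta) (M : C).

Local Notation ext1 := (ext1_csplit (triv M) (triv one)).

Definition prim_cocycle (u : mor M (eqz_ob P)) : mor M (N \ox one) :=
  runV N \co (eqz_map P \co u).

Lemma prim_cocycleP u :
  cocycle (X := triv M) (Y := triv one) (prim_cocycle u).
Proof.
apply/cocycle_primitive; rewrite /prim_cocycle compmA runVK comp1m.
by rewrite /primitive_mor !compmA eqz_comm.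
Qed.

Definition prim_ext (u : mor M (eqz_ob P)) : ext1 :=
  \pi_ext1 (tw_ext (prim_cocycleP u) (some_biproduct (triv M) (triv one))).

Lemma prim_ext_linear : linear prim_ext.
Proof.
move=> c u v.
(* Exposes the Baer operations, on which cocycles add and scale. *)
change (prim_ext (c *: u + v)
        = ext1_add (ext1_scale c (prim_ext u)) (prim_ext v)).
have B := some_biproduct (triv M) (triv one).
rewrite (ext1_scaleE _ _ _ B) (ext1_addE _ _ _ _ (some_biproduct _ _)).
by apply: tw_congr; rewrite /prim_cocycle !(compDr, compZr).
Qed.

Lemma prim_ext_inj : injective prim_ext.
Proof.
move=> u v /pi_ext1 /triv_tw_equiv_eq /runV_inj e.
have [|w [_ wq]] := eqz_univ P (t := eqz_map P \co u).
  by rewrite !compmA eqz_comm.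
by rewrite -(wq u erefl) -(wq v (esym e)).
Qed.

Lemma prim_ext_surj (A : ext1) : exists u, prim_ext u = A.
Proof.
have [z [zP [B ->]]] := ext1_tw A.
have [u [ue _]] := eqz_univ P (iffLR (cocycle_primitive z) zP).
have zE : prim_cocycle u = z by rewrite /prim_cocycle ue compmA runK comp1m.
by exists u; apply: tw_class_eq.
Qed.

End TrivialComodules.

Theorem lemma4p15 (R : realType) (C : moncat (complex R)) (N : coalgebra C)
    (eta : mor (munit C) N)
    (etaP : is_coalg_hom (A := unit_coalgebra C) (B := N) eta)
    (Nprim : primitives eta) (M : C) :
  exists f : {linear ext1_csplit (triv_comod etaP M) (triv_comod etaP (munit C))
                -> mor M (eqz_ob Nprim)},
    bijective f.
Proof.
pose g := prim_ext etaP (P := Nprim) (M := M).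
have gI : injective g by exact: prim_ext_inj.
have /choice [f fK] : forall A, exists u, g u = A by exact: prim_ext_surj.
have f_linear : linear f.
  by move=> c A B; apply: gI; rewrite fK /g prim_ext_linear -/g !fK.
have gK : cancel g f by move=> u; apply: gI; rewrite fK.
pose fL := GRing.isLinear.Build _ _ _ _ f f_linear.
pose F : {linear _ -> _} := HB.pack f fL.
by exists F; exists g.
Qed.
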